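(* Let $V$, $W$ be generalized complex vector spaces with structures $\mathcal J_V$, $\mathcal J_W$, and let $\mu:V\to W$ be an isomorphism of the underlying real vector spaces. If the graph $\{(v,\mu(v)):v\in V\}\subseteq V\oplus W$ of $\mu$ is generalized Lagrangian with respect to the twisted product structure on $V\oplus W$, then $\mu$ induces an isomorphism between the two generalized complex structures, i.e. $(\mu\oplus(\mu^* )^{-1})\circ\mathcal J_V=\mathcal J_W\circ(\mu\oplus(\mu^* )^{-1})$ as maps $V\oplus V^*\to W\oplus W^*$.
   Context: All vector spaces are finite-dimensional. For a subspace $U$ of a real vector space $V$, $\operatorname{Ann}(U)\subseteq V^*$ is the annihilator. On $V\oplus V^*$ use the pairing $\langle v+f,w+g\rangle=-\tfrac12(f(w)+g(v))$. A generalized complex (GC) structure on $V$ is an $\mathbb R$-linear automorphism $\mathcal J$ of $V\oplus V^*$ that is orthogonal for $\langle\cdot,\cdot\rangle$ and satisfies $\mathcal J^2=-1$. Write $\mathcal J=\begin{pmatrix}\mathcal J_1&\mathcal J_2\\ \mathcal J_3&\mathcal J_4\end{pmatrix}$ with $\mathcal J_1:V\to V$, $\mathcal J_2:V^*\to V$, $\mathcal J_3:V\to V^*$, $\mathcal J_4:V^*\to V^*$. A GC vector space is a real vector space with a GC structure. The direct sum of GC structures $\mathcal J_U$ on $U$ and $\mathcal J_V$ on $V$ is the structure on $U\oplus V$ given by $\mathcal J_U\oplus\mathcal J_V$ under the natural identification $(U\oplus V)\oplus(U\oplus V)^*\cong U\oplus U^*\oplus V\oplus V^*$. The twist of $\mathcal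 J$ is $\tilde{\mathcal J}=\begin{pmatrix}\mathcal J_1&-\mathcal J_2\\ -\mathcal J_3&\mathcal J_4\end{pmatrix}$. The twisted product structure on $V\oplus W$ is the direct sum of $\tilde{\mathcal J}_V$ on $V$ and $\mathcal J_W$ on $W$. A subspace $U$ of a GC vector space $(X,\mathcal J)$ is generalized Lagrangian if $U\oplus\operatorname{Ann}(U)\subseteq X\oplus X^*$ is stable under $\mathcal J$. *)

(* Defs.v *)
From HB Require Import structures.
From mathcomp Require Import all_boot all_order all_algebra.
From mathcomp Require Import reals.

Set Implicit Arguments.
Unset Strict Implicit.
Unset Printing Implicit Defensive.

Import GRing.Theory Num.Theory.

Local Open Scope ring_scope.

Section LinearAlgebra.
Variable R : realType.
Implicit Types U V W X Y : vectType R.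

Definition dual V : vectType R := 'Hom(V, R^o).

Definition dual_map V W (m : 'Hom(V, W)) : 'Hom(dual W, dual V) :=
  linfun (fun g : dual W => (g \o m)%VF : dual V).

Lemma dual_mapE V W (m : 'Hom(V, W)) (g : dual W) :
  dual_map m g = (g \o m)%VF.
Proof.
have lin : linear (fun g : dual W => (g \o m)%VF : dual V).
  by move=> a x y; rewrite comp_lfunDl comp_lfunZl.
pose b := GRing.isLinear.Build R (dual W) (dual V) *:%R
  (fun g : dual W => (g \o m)%VF : dual V) lin.
pose F : {linear dual W -> dual V} := HB.pack
  (fun g : dual W => (g \o m)%VF : dual V) b.
exact: (lfunE F).
Qed.

Definition proj1v V W : 'Hom((V * W)%type, V) := linfun fst.
Definition proj2v V W : 'Hom((V * W)%type, W) := linfun snd.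

Lemma proj1vE V W (x : V * W) : proj1v V W x = x.1.
Proof. exact: lfunE. Qed.

Lemma proj2vE V W (x : V * W) : proj2v V W x = x.2.
Proof. exact: lfunE. Qed.

Definition inj1v V W : 'Hom(V, (V * W)%type) := linfun (fun v => (v, 0 : W)).
Definition inj2v V W : 'Hom(W, (V * W)%type) := linfun (fun w => (0 : V, w)).

Lemma inj1vE V W (v : V) : inj1v V W v = (v, 0).
Proof.
have lin : linear (fun v : V => (v, 0 : W)).
  by move=> a x y; congr pair; rewrite /= scaler0 addr0.
pose b := GRing.isLinear.Build R V (V * W)%type *:%R (fun v => (v, 0 : W)) lin.
pose F : {linear V -> (V * W)%type} := HB.pack (fun v : V => (v, 0 : W)) b.
exact: (lfunE F).
Qed.

Lemma inj2vE V W (w : W) : inj2v V W w = (0, w).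
Proof.
have lin : linear (fun w : W => (0 : V, w)).
  by move=> a x y; congr pair; rewrite /= scaler0 addr0.
pose b := GRing.isLinear.Build R W (V * W)%type *:%R (fun w => (0 : V, w)) lin.
pose F : {linear W -> (V * W)%type} := HB.pack (fun w : W => (0 : V, w)) b.
exact: (lfunE F).
Qed.

Definition pair_lfun X V W (f : 'Hom(X, V)) (g : 'Hom(X, W)) :
    'Hom(X, (V * W)%type) :=
  ((inj1v V W \o f) + (inj2v V W \o g))%VF.

Lemma pair_lfunE X V W (f : 'Hom(X, V)) (g : 'Hom(X, W)) x :
  pair_lfun f g x = (f x, g x).
Proof.
rewrite add_lfunE !comp_lfunE inj1vE inj2vE.
by congr pair; rewrite /= ?addr0 ?add0r.
Qed.

Definition prod_lfun X Y V W (f : 'Hom(X, V)) (g : 'Hom(Y, W)) :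
    'Hom((X * Y)%type, (V * W)%type) :=
  pair_lfun (f \o proj1v X Y)%VF (g \o proj2v X Y)%VF.

Lemma prod_lfunE X Y V W (f : 'Hom(X, V)) (g : 'Hom(Y, W)) x :
  prod_lfun f g x = (f x.1, g x.2).
Proof. by rewrite pair_lfunE !comp_lfunE proj1vE proj2vE. Qed.

Definition prodv_sub V W (A : {vspace V}) (B : {vspace W}) :
    {vspace (V * W)%type} :=
  (inj1v V W @: A + inj2v V W @: B)%VS.

Lemma memv_prodv_sub V W (A : {vspace V}) (B : {vspace W}) (x : V * W) :
  (x \in prodv_sub A B) = (x.1 \in A) && (x.2 \in B).
Proof.
apply/memv_addP/andP => [[_ /memv_imgP[a aA ->]]|[x1A x2B]].
  case=> _ /memv_imgP[b bB ->] ->.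
  by rewrite inj1vE inj2vE /= addr0 add0r.
exists (inj1v V W x.1); first exact: memv_img.
exists (inj2v V W x.2); first exact: memv_img.
by rewrite inj1vE inj2vE; case: x {x1A x2B} => a b; congr pair;
  rewrite /= ?addr0 ?add0r.
Qed.

(* The kernel of the restriction map V^* -> U^*. *)
Definition Ann V (U : {vspace V}) : {vspace dual V} :=
  lker (dual_map (linfun (vsval : subvs_of U -> V))).

Lemma memv_Ann V (U : {vspace V}) (f : dual V) :
  reflect {in U, forall u, f u = 0} (f \in Ann U).
Proof.
rewrite memv_ker dual_mapE; apply: (iffP eqP) => [fU0 u uU | fU0].
  have /lfunP/(_ (Subvs uU)) := fU0.
  by rewrite comp_lfunE lfunE zero_lfunE.
by apply/lfunP => u; rewrite comp_lfunE lfunE zero_lfunE fU0 ?subvsP.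
Qed.

Definition graphv V W (m : 'Hom(V, W)) : {vspace (V * W)%type} :=
  limg (pair_lfun \1%VF m).

Lemma memv_graphv V W (m : 'Hom(V, W)) (x : V * W) :
  (x \in graphv m) = (x.2 == m x.1).
Proof.
apply/memv_imgP/eqP => [[v _ ->]|x2E]; first by rewrite pair_lfunE id_lfunE.
exists x.1; first exact: memvf.
by rewrite pair_lfunE id_lfunE -x2E -surjective_pairing.
Qed.

End LinearAlgebra.

Section GeneralizedComplex.
Variable R : realType.
Implicit Types U V W X : vectType R.

Definition gtangent V : vectType R := (V * dual V)%type.

Definition gpairing V (x y : gtangent V) : R :=
  - (2^-1 * ((x.2 : 'Hom(V, R^o)) y.1 + (y.2 : 'Hom(V, R^o)) x.1)).

Record gc_structure V := GCStructure {
  gc_map :> 'End(gtangent V);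
  gc_bij : bijective gc_map;
  gc_orth : forall x y, gpairing (gc_map x) (gc_map y) = gpairing x y;
  gc_sqr : (gc_map \o gc_map = - \1)%VF
}.

Lemma gc_sqrE V (J : gc_structure V) x : J (J x) = - x.
Proof. by rewrite -comp_lfunE gc_sqr opp_lfunE id_lfunE. Qed.

Lemma sqrN1_bij V (J : 'End(gtangent V)) :
  (J \o J = - \1)%VF -> bijective J.
Proof.
move=> J2; have JJ x : J (J x) = - x.
  by rewrite -comp_lfunE J2 opp_lfunE id_lfunE.
by exists (fun x => - J x) => x; rewrite ?linearN /= JJ opprK.
Qed.

Section Blocks.
Variables (V : vectType R) (J : 'End(gtangent V)).

Definition block1 : 'Hom(V, V) :=
  (proj1v V (dual V) \o J \o inj1v V (dual V))%VF.
Definition block2 : 'Hom(dual V, V) :=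
  (proj1v V (dual V) \o J \o inj2v V (dual V))%VF.
Definition block3 : 'Hom(V, dual V) :=
  (proj2v V (dual V) \o J \o inj1v V (dual V))%VF.
Definition block4 : 'Hom(dual V, dual V) :=
  (proj2v V (dual V) \o J \o inj2v V (dual V))%VF.

Definition twist_map : 'End(gtangent V) :=
  pair_lfun
    ((block1 \o proj1v V (dual V)) - (block2 \o proj2v V (dual V)))%VF
    (- (block3 \o proj1v V (dual V)) + (block4 \o proj2v V (dual V)))%VF.

(* Conjugation of J by (v, f) |-> (v, - f). *)
Lemma twist_mapE x :
  twist_map x = ((J (x.1, - x.2)).1, - (J (x.1, - x.2)).2).
Proof.
have -> : (x.1, - x.2) = inj1v V (dual V) x.1 - inj2v V (dual V) x.2.
  by rewrite inj1vE inj2vE; congr pair; rewrite /= ?subr0 ?sub0r.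
rewrite pair_lfunE !(add_lfunE, opp_lfunE, comp_lfunE) !proj1vE !proj2vE.
by rewrite !linearB /= opprK.
Qed.

End Blocks.

Lemma gpairingN2 V (x y : gtangent V) :
  gpairing ((x.1, - x.2) : gtangent V) ((y.1, - y.2) : gtangent V) = - gpairing x y.
Proof. by rewrite /gpairing /= !opp_lfunE -opprD mulrN. Qed.

Lemma twist_map_orth V (J : gc_structure V) x y :
  gpairing (twist_map J x) (twist_map J y) = gpairing x y.
Proof. by rewrite !twist_mapE gpairingN2 gc_orth gpairingN2 opprK. Qed.

Lemma twist_map_sqr V (J : gc_structure V) :
  (twist_map J \o twist_map J = - \1)%VF.
Proof.
apply/lfunP => x; rewrite comp_lfunE !twist_mapE /= opprK -surjective_pairing.
by rewrite gc_sqrE opp_lfunE id_lfunE; congr pair; rewrite /= opprK.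
Qed.

Definition gc_twist V (J : gc_structure V) : gc_structure V :=
  GCStructure (sqrN1_bij (twist_map_sqr J)) (twist_map_orth J)
    (twist_map_sqr J).

(* The natural identification of (U + V) + (U + V)^* with
   (U + U^* ) + (V + V^* ): a form h on U + V goes to its restrictions to the
   two summands, and (f, g) comes back as (u, v) |-> f u + g v. *)
Definition gtangent_split U V :
    'Hom(gtangent (U * V)%type, (gtangent U * gtangent V)%type) :=
  let p := proj1v (U * V)%type (dual (U * V)%type) in
  let q := proj2v (U * V)%type (dual (U * V)%type) in
  pair_lfun
    (pair_lfun (proj1v U V \o p)%VF (dual_map (inj1v U V) \o q)%VF)
    (pair_lfun (proj2v U V \o p)%VF (dual_map (inj2v U V) \o q)%VF).

Definition gtangent_merge U V :
    'Hom((gtangent U * gtangent V)%type, gtangent (U * V)%type) :=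
  let p := proj1v (gtangent U) (gtangent V) in
  let q := proj2v (gtangent U) (gtangent V) in
  pair_lfun
    (pair_lfun (proj1v U (dual U) \o p)%VF (proj1v V (dual V) \o q)%VF)
    ((dual_map (proj1v U V) \o proj2v U (dual U) \o p)
     + (dual_map (proj2v U V) \o proj2v V (dual V) \o q))%VF.

Lemma gtangent_splitE U V (x : gtangent (U * V)%type) :
  gtangent_split U V x =
  ((x.1.1, dual_map (inj1v U V) x.2), (x.1.2, dual_map (inj2v U V) x.2)).
Proof.
by rewrite !pair_lfunE !comp_lfunE !proj1vE !proj2vE.
Qed.

Lemma gtangent_mergeE U V (x : gtangent U * gtangent V) :
  gtangent_merge U V x =
  ((x.1.1, x.2.1), dual_map (proj1v U V) x.1.2 + dual_map (proj2v U V) x.2.2).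
Proof.
by rewrite !pair_lfunE !add_lfunE !comp_lfunE !proj1vE !proj2vE.
Qed.

Lemma gtangent_splitK U V : cancel (gtangent_split U V) (gtangent_merge U V).
Proof.
case=> [[u v] h]; rewrite gtangent_splitE gtangent_mergeE /=; congr pair.
rewrite !dual_mapE; apply/lfunP => -[a b]; rewrite add_lfunE !comp_lfunE proj1vE proj2vE.
by rewrite inj1vE inj2vE -linearD; congr (h _); congr pair;
  rewrite /= ?addr0 ?add0r.
Qed.

Lemma gtangent_mergeK U V : cancel (gtangent_merge U V) (gtangent_split U V).
Proof.
case=> [[u f] [v g]]; rewrite gtangent_mergeE gtangent_splitE /=.
congr ((_, _), (_, _)); rewrite !dual_mapE; apply/lfunP => a.
  by rewrite comp_lfunE inj1vE add_lfunE !comp_lfunE proj1vE proj2vE /= linear0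
    addr0.
by rewrite comp_lfunE inj2vE add_lfunE !comp_lfunE proj1vE proj2vE /= linear0
  add0r.
Qed.

Lemma gpairing_merge U V (x y : gtangent U * gtangent V) :
  gpairing (gtangent_merge U V x) (gtangent_merge U V y) =
  gpairing x.1 y.1 + gpairing x.2 y.2.
Proof.
rewrite !gtangent_mergeE /gpairing /= !dual_mapE !add_lfunE !comp_lfunE !proj1vE !proj2vE /=.
by rewrite -opprD -mulrDr addrACA.
Qed.

Definition direct_sum_map U V (JU : 'End(gtangent U)) (JV : 'End(gtangent V)) :
    'End(gtangent (U * V)%type) :=
  (gtangent_merge U V \o prod_lfun JU JV \o gtangent_split U V)%VF.

Lemma direct_sum_mapE U V (JU : 'End(gtangent U)) (JV : 'End(gtangent V)) x :
  direct_sum_map JU JV x =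
  gtangent_merge U V (JU (gtangent_split U V x).1, JV (gtangent_split U V x).2).
Proof. by rewrite !comp_lfunE prod_lfunE. Qed.

Lemma direct_sum_map_orth U V (JU : gc_structure U) (JV : gc_structure V) x y :
  gpairing (direct_sum_map JU JV x) (direct_sum_map JU JV y) = gpairing x y.
Proof.
rewrite !direct_sum_mapE gpairing_merge /= !gc_orth -gpairing_merge.
by rewrite !gtangent_splitK.
Qed.

Lemma direct_sum_map_sqr U V (JU : gc_structure U) (JV : gc_structure V) :
  (direct_sum_map JU JV \o direct_sum_map JU JV = - \1)%VF.
Proof.
apply/lfunP => x; rewrite comp_lfunE !direct_sum_mapE gtangent_mergeK /=.
rewrite !gc_sqrE opp_lfunE id_lfunE -{3}(gtangent_splitK x).
by rewrite -[RHS]linearN.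
Qed.

Definition gc_direct_sum U V (JU : gc_structure U) (JV : gc_structure V) :
    gc_structure (U * V)%type :=
  GCStructure (sqrN1_bij (direct_sum_map_sqr JU JV))
    (direct_sum_map_orth JU JV) (direct_sum_map_sqr JU JV).

Definition gc_twisted_product V W (JV : gc_structure V) (JW : gc_structure W) :
    gc_structure (V * W)%type :=
  gc_direct_sum (gc_twist JV) JW.

Definition generalized_lagrangian X (J : gc_structure X) (U : {vspace X}) :
    Prop :=
  (J @: prodv_sub U (Ann U) <= prodv_sub U (Ann U))%VS.

(* mu + (mu^* )^-1; the inverse below is the actual inverse of mu^* when mu is
   bijective, and only a partial inverse otherwise. *)
Definition gtangent_map V W (mu : 'Hom(V, W)) : 'Hom(gtangent V, gtangent W) :=
  prod_lfun mu ((dual_map mu)^-1)%VF.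

Lemma dual_map_invK V W (mu : 'Hom(V, W)) : bijective mu ->
  cancel (dual_map mu) ((dual_map mu)^-1)%VF /\
  cancel ((dual_map mu)^-1)%VF (dual_map mu).
Proof.
case=> nu muK nuK.
have ker0 : lker (dual_map mu) == 0%VS.
  apply/lker0P => f g; rewrite !dual_mapE => /lfunP fg; apply/lfunP => w.
  by have := fg (nu w); rewrite !comp_lfunE nuK.
split; first exact: lker0_lfunK.
have mu0 : lker mu == 0%VS by apply/lker0P; exact: can_inj muK.
move=> f; apply: limg_lfunVK; apply/memv_imgP.
exists (f \o mu^-1)%VF; first exact: memvf.
by rewrite dual_mapE -comp_lfunA lker0_compVf // comp_lfun1r.
Qed.

End GeneralizedComplex.

(* Main.v *)
Require Import Defs.
From mathcomp Require Import all_boot all_order all_algebra.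
From mathcomp Require Import reals.

(* Splitting an element of (V + W) + (V + W)^*, the pair ((v, f), (w, g)) lies
   in graph(mu) + Ann(graph(mu)) exactly when w = mu v and f = - mu^* g. So that
   space is the graph of M = mu + (mu^* )^-1 precomposed with the sign change
   s : (v, f) |-> (v, - f). As the twist of J_V is its conjugate by s, stability
   of the space says that M intertwines J_V and J_W. *)

Import GRing.Theory.

Local Open Scope ring_scope.

(** The form given by [p.2] and [q.2] takes the value [p.2 u + q.2 (mu u)] at the point [(u, mu u)]
    of the graph. *)
Lemma gtangent_merge_graph_Ann {R : realType} {V W : vectType R}
    (mu : 'Hom(V, W)) (p : gtangent V) (q : gtangent W) :
  reflect (q.1 = mu p.1 /\ p.2 = - dual_map mu q.2)
    (gtangent_merge V W (p, q) \in prodv_sub (graphv mu) (Ann (graphv mu))).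
Proof.
rewrite memv_prodv_sub gtangent_mergeE memv_graphv /= !dual_mapE.
apply: (iffP andP) => -[].
  move=> /eqP -> /memv_Ann annE; split=> //; apply/lfunP => u.
  have /annE : (u, mu u) \in graphv mu by rewrite memv_graphv.
  rewrite add_lfunE !comp_lfunE proj1vE proj2vE opp_lfunE comp_lfunE /=.
  by move/eqP; rewrite addr_eq0 => /eqP.
move=> -> ->; split=> //; apply/memv_Ann => -[a b].
rewrite memv_graphv /= => /eqP ->.
by rewrite add_lfunE !comp_lfunE proj1vE proj2vE opp_lfunE comp_lfunE addNr.
Qed.

Theorem theorem4 (R : realType) (V W : vectType R)
    (JV : gc_structure V) (JW : gc_structure W)
    (mu : 'Hom(V, W)) (mu_bij : bijective mu) :
  generalized_lagrangian (gc_twisted_product JV JW) (graphv mu) ->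
  (gtangent_map mu \o JV = JW \o gtangent_map mu)%VF.
Proof.
have [dualK dualVK] := dual_map_invK mu_bij.
move=> /subvP lag; apply/lfunP => x; rewrite !comp_lfunE.
set y := gtangent_map mu x.
(* The pair (s x, M x) lies in the space because mu^* undoes (mu^* )^-1. *)
have xyL : gtangent_merge V W ((x.1, - x.2), y)
    \in prodv_sub (graphv mu) (Ann (graphv mu)).
  by apply/gtangent_merge_graph_Ann; rewrite /y prod_lfunE /= dualVK.
have /lag := memv_img (gc_twisted_product JV JW) xyL.
(* As s is an involution, the image is the pair (s (JV x), JW (M x)). Its membership gives the
   V-component directly and the dual one after applying (mu^* )^-1. *)
rewrite /= direct_sum_mapE gtangent_mergeK /= twist_mapE /= opprK.
rewrite -surjective_pairing => /gtangent_merge_graph_Ann[/= JW1 /oppr_inj JV2].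
by rewrite prod_lfunE JV2 dualK -JW1 -surjective_pairing.
Qed.
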